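(* Let $n\ge 3$ be an integer and let $m$ be an integer with $1\le m\le \lfloor n/2\rfloor$. Then $T(n,m) = A(n,m) - A(n-2,m)$.
   Context: An ascending composition of a positive integer $n$ is a sequence of positive integers $\langle a_1,\dots,a_k\rangle$ with $a_1+\dots+a_k=n$ and $a_1\le\dots\le a_k$. For positive integers $m\le n$, $A(n,m)$ denotes the number of ascending compositions of $n$ whose first part satisfies $a_1\ge m$. An ascending composition is called terminal if $k=1$ or $2a_{k-1}\le a_k$. $T(n,m)$ denotes the number of terminal ascending compositions of $n$ whose first part satisfies $a_1\ge m$. *)

(* Defs.v *)
From mathcomp Require Import all_boot all_order all_algebra.

Set Implicit Arguments.
Unset Strict Implicit.
Unset Printing Implicit Defensive.

Definition asc_comp (n : nat) (s : seq nat) : bool :=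
  [&& all (fun a => 0 < a) s, sumn s == n & sorted leq s].

(* Parts are indexed from 0, so a_(k-1) and a_k are at positions k - 2 and k - 1.
   The empty sequence counts as terminal; it only arises for n = 0. *)
Definition terminal (s : seq nat) : bool :=
  (size s == 1) || (2 * nth 0 s (size s - 2) <= nth 0 s (size s - 1)).

(* A composition of n has at most n parts, each at most n, so compositions of n
   are counted inside the finite type {bseq n of 'I_n.+1}; see
   [count_comp_enum]. *)
Definition count_comp (n : nat) (P : pred (seq nat)) : nat :=
  #|[set s : {bseq n of 'I_n.+1} |
      asc_comp n (map val s) && P (map val s)]|.

Definition A (n m : nat) : nat :=
  count_comp n (fun s => m <= head 0 s).

Definition T (n m : nat) : nat :=
  count_comp n (fun s => terminal s && (m <= head 0 s)).

Lemma asc_comp_bseq n s : asc_comp n s ->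
  exists b : {bseq n of 'I_n.+1}, map val b = s.
Proof.
case/and3P=> pos /eqP sum_s _.
have size_s : size s <= n.
  rewrite -sum_s; elim: s pos {sum_s} => //= a s IHs /andP[a_gt0 /IHs].
  by rewrite -add1n; apply: leq_add.
have le_s a : a \in s -> a < n.+1.
  rewrite ltnS -sum_s; elim: s {pos sum_s size_s} => //= b s IHs.
  rewrite inE => /orP[/eqP->|/IHs le_a]; first exact: leq_addr.
  exact: leq_trans le_a (leq_addl _ _).
have size_b : size (map (@inord n) s) <= n by rewrite size_map.
exists (Bseq size_b); rewrite /= -map_comp -[RHS]map_id.
by apply/eq_in_map => a /le_s lt_a /=; rewrite inordK.
Qed.

(* count_comp n P is the length of any duplicate-free list of all the ascending
   compositions of n satisfying P. *)
Lemma count_comp_enum n (P : pred (seq nat)) (l : seq (seq nat)) :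
  uniq l -> (forall s, (s \in l) = asc_comp n s && P s) ->
  count_comp n P = size l.
Proof.
move=> uniq_l mem_l; rewrite /count_comp cardE.
set e := enum _; pose f (b : {bseq n of 'I_n.+1}) := map val b.
have inj_f : injective f.
  by move=> b c /(inj_map val_inj) eq_bc; apply: val_inj.
rewrite -(size_map f); apply/perm_size/uniq_perm => //.
  by rewrite map_inj_uniq // enum_uniq.
move=> s; rewrite mem_l; apply/mapP/andP => [[b]|[comp_s Ps]].
  by rewrite mem_enum inE => /andP[? ?] ->.
have [b def_s] := asc_comp_bseq comp_s.
by exists b; rewrite ?mem_enum ?inE /f def_s ?comp_s.
Qed.

(* Main.v *)
Require Import Defs.
From mathcomp Require Import all_boot all_order all_algebra.
From mathcomp Require Import zify.

(** The non-terminal compositions of n are in bijection with the compositions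
    of n - 2.  Given a composition (..., y, c) of n - 2: if c + 2 < 2 y, replace
    c by c + 2, which keeps the composition non-terminal; otherwise c + 2 >= 2 y
    and c + 2 can be split into its two halves, the smaller one being at least
    y.  The two cases are told apart by whether the last two parts of the result
    differ by at least 2.  The exception is c = 1, where 3 = 1 + 2 would be
    terminal: the all-ones composition is sent to the all-ones composition.

    Compositions are handled reversed, the largest part coming first. *)

(* For m, n > 0 these are the reversals of the compositions counted by A n m:
   appending m as a smallest part makes all parts positive and at least m. *)
Definition desc_comp (n m : nat) (r : seq nat) : bool :=
  sorted geq (rcons r m) && (sumn r == n).

Definition desc_terminal (r : seq nat) : bool :=
  if r is b :: a :: _ then 2 * a <= b else true.

(** For a lone part, [head 0 t] is 0, so any part other than 1 is split. *)
Definition add_two (r : seq nat) : seq nat :=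
  if r is c :: t then
    if c == 1 then 1 :: 1 :: r
    else if c + 2 < 2 * head 0 t then c + 2 :: t
    else uphalf (c + 2) :: (c + 2)./2 :: t
  else [::].

Definition sub_two (r : seq nat) : seq nat :=
  if r is b :: a :: t then
    if a + 2 <= b then b - 2 :: a :: t
    else if a == 1 then t
    else a + b - 2 :: t
  else [::].

Lemma path_geq_rcons_le a t m : path geq a (rcons t m) -> m <= a.
Proof.
elim: t a => [|b t IHt] a /=; first by rewrite andbT.
by case/andP=> /[swap] /IHt; apply: leq_trans.
Qed.

Lemma asc_comp_rev n m r : 0 < n -> 0 < m ->
  asc_comp n (rev r) && (m <= head 0 (rev r)) = desc_comp n m r.
Proof.
move=> n_gt0 m_gt0; rewrite /asc_comp /desc_comp.
have -> : sorted geq (rcons r m) = sorted leq (m :: rev r).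
  by rewrite -[rcons r m]revK rev_sorted rev_rcons.
rewrite -(sumn_rev r); case: (rev r) => [|a s] /=.
  by rewrite (ltn_eqF n_gt0).
have [le_ma|] := leqP m a; last by rewrite andbF.
have [asc_s|_] := boolP (path leq a s); last by rewrite !andbF.
rewrite (leq_trans m_gt0 le_ma) !andbT /=.
have -> : all (fun b => 0 < b) s; last by [].
move: asc_s; rewrite path_sortedE; last exact: leq_trans.
case/andP=> /allP le_as _; apply/allP=> b /le_as.
exact/leq_trans/leq_trans/le_ma.
Qed.

Lemma terminal_rev r : terminal (rev r) = desc_terminal r.
Proof.
case: r => [|b [|a t]] //; rewrite /terminal size_rev !nth_rev /=; try lia.
by rewrite !subSS !subn0 subSn // subnn.
Qed.

Lemma add_twoP n m r : 0 < n -> 0 < m -> m <= (n + 2) %/ 2 ->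
  desc_comp n m r ->
  [/\ desc_comp (n + 2) m (add_two r), ~~ desc_terminal (add_two r)
    & sub_two (add_two r) = r].
Proof.
rewrite /desc_comp => n_gt0 m_gt0 le_mn.
case: r => [|c t] /=; first by lia.
case/andP=> desc_t /eqP sum_ct; have le_mc := path_geq_rcons_le _ _ _ desc_t.
have [c1|c_neq1] := eqVneq c 1.
  by subst c; split=> //=; rewrite desc_t /=; lia.
case: ifP => [lt_c2y|/negbT ge_c2y].
  case: t lt_c2y desc_t sum_ct => [|y t] /=; first by lia.
  move=> lt_c2y /andP[le_yc desc_t] sum_ct; rewrite desc_t; split; try lia.
  by rewrite ifT; [congr (_ :: _); lia | lia].
have desc_ht : path geq (c + 2)./2 (rcons t m).
  (* A lone part is [c = n], and the bound on [m] keeps its lower half at least [m]. *)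
  case: t ge_c2y desc_t sum_ct => [|y t] /= ge_c2y; first by lia.
  by case/andP=> _ ->; lia.
rewrite /= desc_ht; split; try lia.
(* The halves differ by at most 1, and the lower one is at least 2 because [c >= 2]. *)
rewrite ifF; last by lia.
by rewrite ifF; [congr (_ :: _); lia | lia].
Qed.

Lemma sub_twoP n m s : 0 < n -> 0 < m ->
  desc_comp (n + 2) m s -> ~~ desc_terminal s ->
  desc_comp n m (sub_two s) /\ add_two (sub_two s) = s.
Proof.
rewrite /desc_comp => n_gt0 m_gt0; case: s => [|b [|a t]] //=.
case/andP=> /andP[le_ab desc_t] /eqP sum_s nterm.
have le_ma := path_geq_rcons_le _ _ _ desc_t.
case: ifP => [le_a2b|/negbT gt_a2b] /=.
  rewrite desc_t; split; first by lia.
  (* If [b] were 3, then [a] would be 1 and the composition terminal. *)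
  rewrite ifF; last by lia.
  by rewrite ifT; [congr (_ :: _); lia | lia].
have [a1|a_neq1] := eqVneq a 1.
  have b1 : b = 1 by lia.
  subst a b; case: t desc_t sum_s {nterm} => [|y t] /=; first by lia.
  case/andP=> le_y1 desc_t sum_s; have le_my := path_geq_rcons_le _ _ _ desc_t.
  have y1 : y = 1 by lia.
  by subst y; rewrite desc_t; split=> //; lia.
rewrite /=; split.
  case: t desc_t sum_s => [|y t] /=; first by lia.
  by case/andP=> le_ya -> ?; lia.
have le_ya : head 0 t <= a by case: t desc_t {sum_s} => //= y t /andP[].
(* Since [a <= b <= a + 1], splitting [a + b] into halves gives back [a] and [b]. *)
rewrite ifF; last by lia.
rewrite ifF; last by lia.
by congr [:: _, _ & _]; lia.
Qed.

Lemma count_comp_split n (P Q : pred (seq nat)) :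
  count_comp n P = count_comp n (fun s => Q s && P s)
                 + count_comp n (fun s => ~~ Q s && P s).
Proof.
rewrite /count_comp -(cardsID [set s : {bseq n of 'I_n.+1} | Q (map val s)]).
by congr (_ + _); apply: eq_card => s; rewrite !inE /=;
   case: (Q _); rewrite /= ?andbT ?andbF.
Qed.

(** Provides a list for [count_comp_enum], so that counts can be compared by mapping a bijection
    over it. *)
Lemma comp_enum n (P : pred (seq nat)) :
  exists2 l : seq (seq nat), uniq l & forall s, (s \in l) = asc_comp n s && P s.
Proof.
pose f (b : {bseq n of 'I_n.+1}) := map val b.
exists (map f (enum [set b | asc_comp n (f b) && P (f b)])).
  rewrite map_inj_uniq ?enum_uniq // => b c /(inj_map val_inj) eq_bc.
  exact: val_inj.
move=> s; apply/mapP/idP => [[b]|comp_s].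
  by rewrite mem_enum inE => ? ->.
have [/asc_comp_bseq[b def_s] _] := andP comp_s.
by exists b; rewrite // mem_enum inE /f def_s.
Qed.

Lemma count_nonterminal n m : 0 < n -> 0 < m -> m <= (n + 2) %/ 2 ->
  count_comp (n + 2) (fun s => ~~ terminal s && (m <= head 0 s)) = A n m.
Proof.
move=> n_gt0 m_gt0 le_mn.
have [l uniq_l mem_l] := comp_enum n (fun s => m <= head 0 s).
have mem_rev r : (rev r \in l) = desc_comp n m r by rewrite mem_l asc_comp_rev.
rewrite /A (count_comp_enum uniq_l mem_l).
pose f s := rev (add_two (rev s)).
rewrite -(size_map f); apply: count_comp_enum.
  rewrite map_inj_in_uniq // => s t; rewrite -[s]revK -[t]revK !mem_rev.
  case/add_twoP=> // _ _ sK /add_twoP[] // _ _ tK.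
  rewrite /f !revK => /(can_inj revK) eq_st; apply: (can_inj revK).
  by rewrite -sK eq_st tK.
move=> s; rewrite -[s]revK terminal_rev; move: (rev s) => {s} s.
rewrite andbCA asc_comp_rev ?addn_gt0 ?n_gt0 //.
apply/mapP/andP => [[t]|[nterm_s comp_s]].
  rewrite -[t]revK mem_rev => /add_twoP[] // comp_t nterm_t _.
  by rewrite /f revK => /(can_inj revK) ->.
have [comp_t sK] := sub_twoP _ _ _ n_gt0 m_gt0 comp_s nterm_s.
by exists (rev (sub_two s)); rewrite ?mem_rev // /f revK sK.
Qed.

Theorem theorem4p5 (n m : nat) (hn : 3 <= n) (hm1 : 1 <= m) (hm2 : m <= n %/ 2) :
  ((T n m)%:Z = (A n m)%:Z - (A (n - 2)%N m)%:Z)%R.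
Proof.
have n2K : n - 2 + 2 = n by rewrite subnK // ltnW.
have nterm := count_nonterminal (n - 2) m.
rewrite n2K subn_gt0 in nterm.
(* Splitting [A n m] by [terminal] leaves [T n m] plus the nonterminal count, which cancels. *)
rewrite -(nterm hn hm1 hm2) {1}/A (count_comp_split _ _ terminal).
by rewrite PoszD GRing.addrK.
Qed.
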